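(* Let $q$ be an odd prime and $n$ a positive integer. Then the smallest integer $m>1$ such that the numbers $k^q(k-1)^q$ with $k=1,\ldots,n$ are pairwise distinct modulo $m$ is the least prime $p\geqslant 2n-1$ with $p\not\equiv 1\pmod q$. *)

(* Defs.v *)
From mathcomp Require Import all_boot.

Set Implicit Arguments.
Unset Strict Implicit.
Unset Printing Implicit Defensive.

Definition is_least (P : nat -> Prop) (m : nat) : Prop :=
  P m /\ forall m' : nat, P m' -> m <= m'.

(* The truncated subtraction [k - 1] is exact, since [k] is at least 1. *)
Definition distinct_mod (q n m : nat) : Prop :=
  forall j k : nat, 1 <= j <= n -> 1 <= k <= n -> j <> k ->
    j ^ q * (j - 1) ^ q <> k ^ q * (k - 1) ^ q %[mod m].

(* Main.v *)
Require Import Defs.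
From mathcomp Require Import all_boot all_order all_algebra all_solvable.
From mathcomp Require Import reals exp Rstruct.
From mathcomp Require Import zify ring lra.

Set Implicit Arguments.
Unset Strict Implicit.
Unset Printing Implicit Defensive.

Import Order.TTheory GRing.Theory Num.Theory.

(** Since [k (k - 1) - j (j - 1) = (k - j) (k + j - 1)] and [x |-> x ^ q] is
    injective modulo a prime [p] that is not 1 modulo [q], every such
    [p >= 2 n - 1] separates the numbers [k ^ q (k - 1) ^ q].

    Conversely, let [m] separate them. As these numbers are divisible by
    [2 ^ q], a factor of [m] that is a power of 2 is either useless or large.
    If [m = x y] with [x + y] odd, there are [j < k] with [k - j] and
    [k + j - 1] equal to [x] and [y], hence [2 n <= x + y]; this forces
    [m >= 2 n - 1], and [m >= 6 n - 17] unless the odd part of [m] is prime.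
    For a prime [m] that is 1 modulo [q] there are only [(m - 1) / q] nonzero
    [q]-th powers, so [m >= q (n - 1) + 1].

    It remains to find a prime that is not 1 modulo [q] in the interval from
    [2 n - 1] to [3 n - 2] if [q = 3], and to [5 n - 4] if [q >= 5]. For large
    [n] this is done in the manner of Chebyshev, by comparing sums of logarithms
    over integers in residue classes with sums over prime powers; small [n] are
    covered by explicit primes. *)

(** * Logarithms and sums over prime powers *)

Section LogSums.
Context {R : realType}.
Local Open Scope ring_scope.

Definition lnn (n : nat) : R := ln n%:R.

Lemma lnn1 : lnn 1 = 0.
Proof. by rewrite /lnn ln1. Qed.

Lemma lnnM a b : (0 < a)%N -> (0 < b)%N -> lnn (a * b)%N = lnn a + lnn b.
Proof. by move=> a0 b0; rewrite /lnn natrM lnM // posrE ltr0n. Qed.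

Lemma lnnX p j : (0 < p)%N -> lnn (p ^ j)%N = lnn p * j%:R.
Proof. by move=> p0; rewrite /lnn natrX lnXn ?ltr0n // mulr_natr. Qed.

Lemma ler_lnn a b : (0 < a)%N -> (a <= b)%N -> lnn a <= lnn b.
Proof.
move=> a0 ab; rewrite /lnn ler_ln ?posrE ?ltr0n ?ler_nat //.
exact: leq_trans ab.
Qed.

Lemma lnn_ge0 n : 0 <= lnn n.
Proof.
case: n => [|n]; first by rewrite /lnn ln0.
by rewrite -lnn1 ler_lnn.
Qed.

(** This is [ln (1 + x) <= x] at [x = a / b - 1], the one analytic estimate from which all numerical
    bounds below descend. *)
Lemma lnn_sub_le a b : (0 < a)%N -> (0 < b)%N ->
  b%:R * (lnn a - lnn b) <= a%:R - b%:R.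
Proof.
move=> a0 b0; have aR : 0 < a%:R :> R by rewrite ltr0n.
have bR : 0 < b%:R :> R by rewrite ltr0n.
rewrite /lnn -ln_div ?posrE //.
have -> : a%:R / b%:R = 1 + (a%:R / b%:R - 1) :> R by ring.
have : -1 < a%:R / b%:R - 1 :> R by have := divr_gt0 aR bR; lra.
move/le_ln1Dx => h.
have -> : a%:R - b%:R = b%:R * (a%:R / b%:R - 1) :> R by field; lra.
by rewrite ler_pM2l.
Qed.

(* [vM N F] is the sum of [Lambda d * F d] over prime powers [d], where
   [Lambda] is von Mangoldt's function; the exponent range is harmless, as
   every [F] of interest vanishes above [N]. *)
Definition vM (N : nat) (F : nat -> nat) : R :=
  \sum_(0 <= p < N.+1 | prime p) \sum_(1 <= j < N.+1) lnn p * (F (p ^ j)%N)%:R.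

Lemma vMD N F G : vM N (fun d => F d + G d)%N = vM N F + vM N G.
Proof.
rewrite /vM -big_split; apply: eq_bigr => p _.
by rewrite -big_split; apply: eq_bigr => j _; rewrite natrD mulrDr.
Qed.

Lemma ler_vM_pow N F G :
  (forall p j, prime p -> (0 < j)%N -> (F (p ^ j) <= G (p ^ j))%N) ->
  vM N F <= vM N G.
Proof.
move=> FG; apply: ler_sum => p pr_p; rewrite big_nat_cond [leRHS]big_nat_cond.
apply: ler_sum => j /andP[/andP[j0 _] _].
by rewrite ler_wpM2l ?lnn_ge0 // ler_nat FG.
Qed.

Lemma ler_vM N F G : (forall d, (0 < d)%N -> (F d <= G d)%N) ->
  vM N F <= vM N G.
Proof.
move=> FG; apply: ler_vM_pow => p j /prime_gt0 p0 _.
by rewrite FG ?expn_gt0 ?p0.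
Qed.

Lemma eq_vM N F G : (forall d, (0 < d)%N -> F d = G d) -> vM N F = vM N G.
Proof. by move=> FG; apply/le_anti/andP; split; apply: ler_vM => d /FG ->. Qed.

Lemma vM0 N : vM N (fun=> 0%N) = 0.
Proof.
by rewrite /vM big1 // => p _; rewrite big1 // => j _; rewrite mulr0.
Qed.

Lemma sum_dvd_logn p n N : prime p -> (0 < n <= N)%N ->
  (\sum_(1 <= j < N.+1) (p ^ j %| n) = logn p n)%N.
Proof.
move=> pr_p /andP[n0 nN].
have lN : (logn p n <= N)%N.
  by rewrite (leq_trans _ nN) // ltnW // ltn_logl.
rewrite (eq_bigr (fun j => (j <= logn p n)%N : nat)); last first.
  by move=> j _; rewrite pfactor_dvdn.
rewrite (@big_cat_nat _ _ _ (logn p n).+1) //=.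
rewrite [X in (X + _)%N](eq_big_nat _ _ (F2 := fun=> 1%N)); last first.
  by move=> j; rewrite ltnS => /andP[_ ->].
rewrite [X in (_ + X)%N](eq_big_nat _ _ (F2 := fun=> 0%N)); last first.
  by move=> j /andP[/ltn_geF ->].
by rewrite big1_eq sum_nat_const_nat muln1 addn0 subn1.
Qed.

(** The prime [p] contributes [lnn p] once for each [j] with [p ^ j] dividing [n], hence [logn p n]
    times; this is the factorisation of [n]. *)
Lemma lnn_vM N n : (0 < n <= N)%N -> lnn n = vM N (fun d => (d %| n)%N).
Proof.
move=> /[dup] nN /andP[n0 nleN].
have prodL (s : seq nat) (P : pred nat) F : (forall i, P i -> 0 < F i)%N ->
    lnn (\prod_(i <- s | P i) F i)%N = \sum_(i <- s | P i) lnn (F i).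
  move=> F0; pose K (x : nat) (y : R) := (0 < x)%N /\ lnn x = y.
  have: K (\prod_(i <- s | P i) F i)%N (\sum_(i <- s | P i) lnn (F i)).
    apply: (big_ind2 K) => [|x1 x2 y1 y2 [? <-] [? <-]|i /F0].
    - by split=> //; rewrite lnn1.
    - by split; [rewrite muln_gt0; apply/andP | rewrite lnnM].
    - by split.
  by case.
have -> : vM N (fun d => (d %| n)%N) =
    \sum_(0 <= p < N.+1 | prime p) lnn (p ^ logn p n)%N.
  apply: eq_bigr => p pr_p.
  rewrite lnnX ?prime_gt0 // -(sum_dvd_logn pr_p nN) -mulr_sumr.
  by rewrite natr_sum.
rewrite -prodL; last by move=> p /prime_gt0 p0; rewrite expn_gt0 p0.
congr lnn; rewrite -[LHS](partnT n0) (widen_partn predT nleN).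
rewrite [RHS]big_mkcond; apply: eq_bigr => p _.
by case: ifP => // npr_p; rewrite lognE npr_p expn0.
Qed.

(** * Sums of logarithms over integers *)

Definition lsum (P : pred nat) (y : nat) : R :=
  \sum_(1 <= n < y.+1 | P n) lnn n.

Definition cnt (P : pred nat) (u : nat) : nat := \sum_(1 <= e < u.+1) P e.

Lemma cnt0 P : cnt P 0 = 0%N.
Proof. by rewrite /cnt big_geq. Qed.

Lemma cntS P u : cnt P u.+1 = (cnt P u + P u.+1)%N.
Proof. by rewrite /cnt big_nat_recr. Qed.

Lemma lsum0 P : lsum P 0 = 0.
Proof. by rewrite /lsum big_geq. Qed.

Lemma lsumS P y : lsum P y.+1 = lsum P y + (if P y.+1 then lnn y.+1 else 0).
Proof. by rewrite /lsum big_mkcond big_nat_recr //= -big_mkcond. Qed.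

(** Exchange of summation over [n = d * e]. In the induction, [y %/ d] grows only when [d] divides
    [y.+1], and the new [e] is that quotient. *)
Lemma lsum_vM P N y : (y <= N)%N ->
  lsum P y = vM N (fun d => cnt (fun e => P (d * e)%N) (y %/ d)%N).
Proof.
elim: y => [|y IH] yN.
  rewrite lsum0 -[LHS](vM0 N); apply: eq_vM => d d0.
  by rewrite div0n cnt0.
rewrite lsumS IH ?(ltnW yN) //.
have -> : (if P y.+1 then lnn y.+1 else 0) =
    vM N (fun d => P y.+1 && (d %| y.+1)%N).
  by case: ifP => _; rewrite ?vM0 // -lnn_vM ?yN.
rewrite -vMD; apply: eq_vM => d d0; rewrite divnS //.
case: dvdnP => [[e ye]|_] /=; last by rewrite andbF addn0.
have -> : (y %/ d = e.-1)%N.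
  have -> : (y = e.-1 * d + d.-1)%N by case: e ye => //; lia.
  by rewrite divnMDl // divn_small ?addn0 // ltn_predL.
case: e ye => [//|e] ye; rewrite add1n cntS andbT.
by rewrite ye mulnC.
Qed.

Definition lfact (y : nat) : R := lsum predT y.

Lemma lfactS y : lfact y.+1 = lfact y + lnn y.+1.
Proof. exact: lsumS. Qed.

Lemma lfact_vM N y : (y <= N)%N -> lfact y = vM N (fun d => y %/ d)%N.
Proof.
move=> yN; rewrite /lfact (@lsum_vM _ N) //; apply: eq_vM => d _.
by rewrite /cnt sum_nat_const_nat muln1 subn1.
Qed.

Lemma lfact_ge y : (0 < y)%N -> y%:R * lnn y - y%:R + 1 <= lfact y.
Proof.
elim: y => [//|[|y] IH] _; first by rewrite lfactS /lfact lsum0 lnn1; lra.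
rewrite lfactS; have := @lnn_sub_le y.+2 y.+1 isT isT.
by move: (IH isT); rewrite -[y.+2%:R]natr1; lra.
Qed.

Lemma lfact_le y : (0 < y)%N ->
  lfact y <= y%:R * lnn y - y%:R + lnn y + 1.
Proof.
elim: y => [//|[|y] IH] _; first by rewrite lfactS /lfact lsum0 lnn1; lra.
rewrite lfactS; have := @lnn_sub_le y.+1 y.+2 isT isT.
by move: (IH isT); rewrite -[y.+2%:R]natr1; lra.
Qed.

(** A weak Stirling formula. Replacing the floor [y] by the exact quotient [t] costs at most one
    logarithm, since [lnn X - lnn k] lies between [lnn y] and [lnn y.+1]; the case [y = 0] is
    separate. *)
Lemma lfact_div_bounds X k : (0 < X)%N -> (0 < k)%N ->
  X%:R / k%:R * (lnn X - lnn k - 1) - lnn X <= lfact (X %/ k) <=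
  X%:R / k%:R * (lnn X - lnn k - 1) + lnn X + 2.
Proof.
move=> X0 k0; have kR : 0 < k%:R :> R by rewrite ltr0n.
have XR : 0 < X%:R :> R by rewrite ltr0n.
set t := X%:R / k%:R; have tk : t * k%:R = X%:R by rewrite divfK ?gt_eqF.
have t0 : 0 < t by exact: divr_gt0.
have LX := lnn_ge0 X; have Lk := lnn_ge0 k.
have [y0|] := posnP (X %/ k).
  have Xk : (X < k)%N by rewrite ltnNge -divn_gt0 // y0.
  rewrite y0 /lfact lsum0.
  have h1 : lnn X <= lnn k by rewrite ler_lnn // ltnW.
  have h2 := @lnn_sub_le _ _ k0 X0.
  have h3 : t * (lnn k - lnn X) <= 1 - t.
    rewrite -(ler_pM2r kR) mulrBl tk mul1r.
    by have -> : t * (lnn k - lnn X) * k%:R = X%:R * (lnn k - lnn X)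
      by rewrite -tk; ring.
  by apply/andP; split; nra.
set y := (X %/ k)%N => y0.
have Xy := divn_eq X k; have Xk := ltn_pmod X k0; rewrite -/y in Xy.
have h1 : y%:R <= t.
  by rewrite -(ler_pM2r kR) tk -natrM ler_nat [leqRHS]Xy leq_addr.
have h2 : t <= y%:R + 1.
  rewrite -(ler_pM2r kR) tk natr1 -natrM ler_nat [leqLHS]Xy mulSn addnC.
  by rewrite leq_add2r ltnW.
have h3 : lnn X <= lnn k + lnn y.+1.
  by rewrite -lnnM // ler_lnn // [leqLHS]Xy mulnS mulnC addnC leq_add2r ltnW.
have h4 : lnn k + lnn y <= lnn X.
  by rewrite -lnnM // ler_lnn ?muln_gt0 ?k0 // [leqRHS]Xy mulnC leq_addr.
have h5 := @lnn_sub_le y.+1 y isT y0.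
have h6 := @lfact_ge _ y0; have h7 := @lfact_le _ y0.
have Ly := lnn_ge0 y; have yR : 0 < y%:R :> R by rewrite ltr0n.
move: h5; rewrite -natr1 => h5.
set D := lnn X - lnn k in h3 h4 *.
have D0 : 0 <= D by rewrite /D; lra.
have tD1 : t * D <= (y%:R + 1) * D by rewrite ler_wpM2r.
have tD2 : y%:R * D <= t * D by rewrite ler_wpM2r.
have yD1 : y%:R * D <= y%:R * lnn y.+1 by rewrite ler_pM2l // /D; lra.
have yD2 : y%:R * lnn y <= y%:R * D by rewrite ler_pM2l // /D; lra.
have DX : D <= lnn X by rewrite /D; lra.
have DX' : lnn y <= D by rewrite /D; lra.
by apply/andP; split; lra.
Qed.

(* Consequences of the comparisons 225/224, 2401/2400, 4375/4374 and 126/125,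
   whose logarithms determine those of 2, 3, 5 and 7. *)
Lemma lnn_small_bounds :
  [/\ 917 / 1000 <= 7 / 15 * lnn 2 + 3 / 10 * lnn 3 + 1 / 6 * lnn 5
                 <= 925 / 1000,
      178 / 100 <= lnn 2 + lnn 3, lnn 2 <= 7 / 10, 109 / 100 <= lnn 3
    & lnn 5 <= 162 / 100].
Proof.
have sm a b : (0 < a)%N -> (0 < b)%N ->
    b%:R * (lnn a - lnn b) <= a%:R - b%:R /\
    a%:R * (lnn b - lnn a) <= b%:R - a%:R.
  by move=> a0 b0; split; apply: lnn_sub_le.
have [] := sm (3 * 3 * 5 * 5)%N (2 * 2 * 2 * 2 * 2 * 7)%N isT isT.
have [] := sm (7 * 7 * 7 * 7)%N (2 * 2 * 2 * 2 * 2 * 3 * 5 * 5)%N isT isT.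
have [] := sm (5 * 5 * 5 * 5 * 7)%N (2 * 3 * 3 * 3 * 3 * 3 * 3 * 3)%N isT isT.
have [] := sm (2 * 3 * 3 * 7)%N (5 * 5 * 5)%N isT isT.
rewrite !lnnM ?muln_gt0 // !natrM.
by move=> *; split; [apply/andP; split|..]; lra.
Qed.

(** * Chebyshev's bounds *)

(** Chebyshev's function for [y <= N]; the fixed cutoff [N] allows termwise comparison at different
    arguments [y]. *)
Definition psi (N y : nat) : R := vM N (fun d => (d <= y)%N).

(** With [u = y %/ d], the combination [u - u %/ 2 - u %/ 3 - u %/ 5 + u %/ 30] is always 0 or 1,
    and it is 1 for [1 <= u < 6], which gives the converse bound below. *)
Lemma chebyshev_psi_ge N y : (y <= N)%N ->
  lfact y + lfact (y %/ 30) <=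
  lfact (y %/ 2) + lfact (y %/ 3) + lfact (y %/ 5) + psi N y.
Proof.
move=> yN; have le k : (y %/ k <= N)%N by exact: leq_trans (leq_div _ _) yN.
rewrite /psi !(@lfact_vM N) // -!vMD; apply: ler_vM => d d0.
rewrite !(divnAC y _ d) -(divn_gt0 _ d0).
by move: (y %/ d)%N => u; case: u => // u; lia.
Qed.

Lemma chebyshev_psi_le N y : (y <= N)%N ->
  lfact (y %/ 2) + lfact (y %/ 3) + lfact (y %/ 5) + psi N y <=
  lfact y + lfact (y %/ 30) + psi N (y %/ 6).
Proof.
move=> yN; have le k : (y %/ k <= N)%N by exact: leq_trans (leq_div _ _) yN.
rewrite /psi !(@lfact_vM N) // -!vMD; apply: ler_vM => d d0.
rewrite -!(divn_gt0 _ d0) !(divnAC y _ d).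
by move: (y %/ d)%N => u; lia.
Qed.

(** As [1 + 1/30 = 1/2 + 1/3 + 1/5], the terms in [y * (lnn y - 1)] cancel. What remains is [y]
    times Chebyshev's constant 0.9212..., and each of the five [lfact] costs one logarithm. *)
Lemma chebyshev_sum_bounds N y : (0 < y <= N)%N ->
  `| lfact y + lfact (y %/ 30) - lfact (y %/ 2) - lfact (y %/ 3)
     - lfact (y %/ 5) -
     y%:R * (lnn 2 / 2 + lnn 3 / 3 + lnn 5 / 5 - lnn 30 / 30) |
  <= 5 * lnn N + 6.
Proof.
move=> /andP[y0 yN]; have yR : 0 < y%:R :> R by rewrite ltr0n.
have := @lfact_div_bounds y 1 y0 isT; have := @lfact_div_bounds y 2 y0 isT.
have := @lfact_div_bounds y 3 y0 isT; have := @lfact_div_bounds y 5 y0 isT.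
have := @lfact_div_bounds y 30 y0 isT; rewrite divn1 lnn1.
have := @ler_lnn _ _ y0 yN.
move=> h /andP[? ?] /andP[? ?] /andP[? ?] /andP[? ?] /andP[? ?].
by rewrite ler_norml; apply/andP; split; lra.
Qed.

Lemma lnn30 : lnn 30 = lnn 2 + lnn 3 + lnn 5.
Proof. by rewrite (_ : 30 = 2 * 3 * 5)%N // !lnnM. Qed.

Lemma psi_ge N : (0 < N)%N ->
  91 / 100 * N%:R - 5 * lnn N - 6 <= psi N N.
Proof.
move=> N0; have := @chebyshev_psi_ge N N (leqnn _).
have := @chebyshev_sum_bounds N N; rewrite N0 leqnn => /(_ isT).
rewrite ler_norml lnn30 => /andP[h1 h2].
case: lnn_small_bounds => /andP[? ?] _ _ _ _ h3.
have : 91 / 100 * N%:R <= N%:R * (lnn 2 / 2 + lnn 3 / 3 + lnn 5 / 5 -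
  (lnn 2 + lnn 3 + lnn 5) / 30) by rewrite mulrC ler_wpM2l //; lra.
lra.
Qed.

(** Iterate [chebyshev_psi_le]: the geometric series gives [6/5 * 925/1000 = 111/100], and [r]
    bounds the number of divisions by 6. *)
Lemma psi_le N y r : (y <= N)%N -> (y < 6 ^ r)%N ->
  psi N y <= 111 / 100 * y%:R + r%:R * (5 * lnn N + 6).
Proof.
elim: r y => [|r IH] y yN yr.
  have -> : y = 0%N by lia.
  rewrite mulr0 mul0r addr0 -(vM0 N) /psi; apply: ler_vM => d.
  by case: d.
have [->|y0] := posnP y.
  rewrite mulr0 add0r (_ : psi N 0 = 0); last first.
    by rewrite -(vM0 N) /psi; apply: eq_vM => -[].
  by rewrite mulr_ge0 // addr_ge0 // mulr_ge0 // lnn_ge0.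
have := IH (y %/ 6)%N (leq_trans (leq_div _ _) yN) _.
rewrite ltn_divLR // -expnSr => /(_ yr) {}IH.
have := @chebyshev_psi_le N y yN.
have := @chebyshev_sum_bounds N y; rewrite y0 yN => /(_ isT).
rewrite ler_norml lnn30 => /andP[h1 h2] h3.
case: lnn_small_bounds => /andP[? ?] _ _ _ _.
have : y%:R * (lnn 2 / 2 + lnn 3 / 3 + lnn 5 / 5 -
  (lnn 2 + lnn 3 + lnn 5) / 30) <= y%:R * (925 / 1000).
  by rewrite ler_wpM2l //; lra.
have : (y %/ 6)%:R * 6 <= y%:R :> R by rewrite -natrM ler_nat leq_divM.
rewrite -[r.+1%:R]natr1; lra.
Qed.

(** * Prime powers in residue classes *)

Lemma sum_pos_leq_le n s : (\sum_(0 <= p < n) (0 < p <= s) <= s)%N.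
Proof.
suff : (\sum_(0 <= p < n) (0 < p <= s) <= minn n.-1 s)%N by lia.
elim: n => [|n IH]; first by rewrite big_geq.
by rewrite big_nat_recr //=; move: IH; case: n => [|n]; lia.
Qed.

Lemma sum_prime_pow_le N p y : prime p ->
  \sum_(1 <= j < N.+1) lnn p * (p ^ j <= y)%N%:R <= lnn y.
Proof.
move=> pr_p; have p1 := prime_gt1 pr_p; have p0 := prime_gt0 pr_p.
have [->|y0] := posnP y.
  rewrite big1 ?lnn_ge0 // => j _; rewrite leqn0 expn_eq0.
  by rewrite (gtn_eqF p0) mulr0.
rewrite -mulr_sumr -natr_sum.
apply: (@le_trans _ _ (lnn p * (trunc_log p y)%:R)).
  rewrite ler_wpM2l ?lnn_ge0 // ler_nat.
  apply: leq_trans (sum_pos_leq_le N.+1 _).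
  rewrite [leqRHS]big_ltn //= add0n big_nat_cond [leqRHS]big_nat_cond.
  apply: leq_sum => j /andP[/andP[j0 _] _]; rewrite j0 /=.
  by case: (leqP (p ^ j) y) => // pj; rewrite trunc_log_max.
by rewrite -lnnX // ler_lnn ?expn_gt0 ?p0 // trunc_logP.
Qed.

Lemma sum_pred1_le n (P : pred nat) q (c : R) : 0 <= c ->
  \sum_(0 <= p < n | P p) (if p == q then c else 0) <= c.
Proof.
move=> c0; have [qn|qn] := boolP (q \in index_iota 0 n).
  rewrite -big_mkcondr /= big_mkcond (bigD1_seq q) ?iota_uniq //= eqxx andbT.
  rewrite big1 ?addr0; first by case: ifP.
  by move=> i /negbTE ->; rewrite andbF.
rewrite big_seq_cond big1 // => p /andP[pn _].
by case: eqP => // pq; rewrite pq (negbTE qn) in pn.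
Qed.

Lemma vM_dvd_le N q (F : nat -> nat) (c : R) : prime q -> 0 <= c ->
  \sum_(1 <= j < N.+1) lnn q * (F (q ^ j)%N)%:R <= c ->
  vM N (fun d => if (q %| d)%N then F d else 0%N) <= c.
Proof.
move=> pr_q c0 Fc.
apply: le_trans (sum_pred1_le N.+1 prime q c0); apply: ler_sum => p pr_p.
case: eqP => [->|/eqP pq].
  apply: le_trans Fc; apply: ler_sum => j _.
  by rewrite ler_wpM2l ?lnn_ge0 // ler_nat; case: ifP.
rewrite big_nat_cond big1 // => j /andP[/andP[j0 _] _].
by rewrite Euclid_dvdX // j0 andbT dvdn_prime2 // eq_sym (negbTE pq) mulr0.
Qed.

(** A proper prime power up to [N] has its base at most [s], and the powers of one base contribute
    at most [lnn N]. *)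
Lemma vM_nonprime_le N s : (N < s.+1 ^ 2)%N ->
  vM N (fun d => ~~ prime d && (d <= N)%N) <= s%:R * lnn N.
Proof.
move=> Ns.
apply: (@le_trans _ _ (\sum_(0 <= p < N.+1) (0 < p <= s)%N%:R * lnn N)).
  rewrite /vM big_mkcond; apply: ler_sum => p _.
  case: ifP => [pr_p|_]; last by rewrite mulr_ge0 // lnn_ge0.
  rewrite prime_gt0 //=; case: leqP => ps; last first.
    rewrite mul0r big_nat_cond big1 // => -[//|[|j]] _.
      by rewrite expn1 pr_p mulr0.
    suff /ltn_geF -> : (N < p ^ j.+2)%N by rewrite andbF mulr0.
    apply: (leq_trans Ns); apply: (@leq_trans (p ^ 2)).
      by rewrite leq_exp2r.
    by rewrite leq_pexp2l // prime_gt0.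
  rewrite mul1r; apply: le_trans (sum_prime_pow_le N N pr_p).
  apply: ler_sum => j _; rewrite ler_wpM2l ?lnn_ge0 // ler_nat.
  by case: (prime _).
rewrite -mulr_suml -natr_sum ler_wpM2r ?lnn_ge0 // ler_nat.
exact: sum_pos_leq_le.
Qed.

(** A geometric series; the extra term [Y %/ q ^ J] makes the induction work. *)
Lemma sum_div_exp_le q Y J : (1 < q)%N ->
  (q.-1 * \sum_(1 <= j < J.+1) Y %/ q ^ j + Y %/ q ^ J <= Y)%N.
Proof.
move=> q1; elim: J => [|J IH]; first by rewrite big_geq // muln0 expn0 divn1.
rewrite big_nat_recr //= mulnDr.
have: (Y %/ q ^ J.+1 * q <= Y %/ q ^ J)%N by rewrite expnSr divnMA leq_divM.
by move: IH; case: q q1 => // q _ /=; lia.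
Qed.

Lemma leq_cnt P u v : (u <= v)%N -> (cnt P u <= cnt P v)%N.
Proof.
move=> /subnKC <-; elim: (v - u)%N => [|k IH]; first by rewrite addn0.
by rewrite addnS cntS (leq_trans IH) // leq_addr.
Qed.

Lemma ltn_cnt (P : pred nat) u e v : P e -> (u < e <= v)%N ->
  (cnt P u < cnt P v)%N.
Proof.
case: e => // e Pe /andP[ue ev].
have := leq_cnt P ev; rewrite cntS Pe addn1; apply: leq_trans.
by rewrite ltnS leq_cnt.
Qed.

(** Each full block of [q] consecutive integers contains an inverse of [d]. *)
Lemma cnt_inv_mod q d u : (1 < q)%N -> coprime d q ->
  (u %/ q <= cnt (fun e => d * e == 1 %[mod q]) u)%N.
Proof.
move=> q1 dq; have q0 := ltnW q1.
have [d0|d0] := posnP d.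
  by move: dq q1; rewrite d0 /coprime gcd0n => /eqP ->.
have [[a b] /= ab] := coprimeP _ d0 dq.
have e1 : d * (a %% q) = 1 %[mod q].
  by rewrite modnMmr (_ : d * a = b * q + 1)%N ?modnMDl //; lia.
have a0 : (0 < a %% q)%N.
  rewrite lt0n; apply/eqP => az; move: e1; rewrite az muln0 mod0n modn_small //.
apply: leq_trans (leq_cnt _ (leq_divM u q)).
elim: (u %/ q)%N => // b' IH; apply: leq_ltn_trans IH _.
apply: (@ltn_cnt _ _ (b' * q + a %% q)%N).
  by rewrite mulnDr mulnA modnMDl e1.
by have := ltn_pmod a q0; rewrite mulSn; lia.
Qed.

(** The terms are [q * i + 1 <= q * i.+1], and the one with [i = 0] has logarithm 0. *)
Lemma lsum_one_mod_le q X : (1 < q)%N ->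
  lsum (fun n => n == 1 %[mod q]) X <=
  (X.-1 %/ q)%:R * lnn q + lfact (X.-1 %/ q).+1.
Proof.
move=> q1; have q0 := ltnW q1; elim: X => [|X IH].
  rewrite lsum0 div0n mul0r add0r lfactS /lfact lsum0 lnn1; lra.
rewrite lsumS /=; case: X IH => [|X] IH.
  rewrite lsum0 div0n mul0r lfactS /lfact lsum0 lnn1 if_same; lra.
have -> : (X.+2 == 1 %[mod q]) = (q %| X.+1)%N.
  by have := eqn_modDr 1 X.+1 0 q; rewrite addn1 add0n mod0n.
rewrite divnS //; case: ifP => [qX|_]; last by rewrite addr0 add0n.
rewrite add1n lfactS -natr1 mulrDl mul1r.
suff : lnn X.+2 <= lnn q + lnn (X %/ q).+2 by move: IH => /=; lra.
rewrite -lnnM // ler_lnn //.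
by have := divn_eq X q; have := ltn_pmod X q0; rewrite !mulnS; lia.
Qed.

(** Compare the product of the [n <= X] that are 1 modulo [q] with the factorial of [Y = X %/ q]. By
    [cnt_inv_mod], each prime power [d] prime to [q] occurs at least as often in the former, and
    those counted in [V] occur there but not in the latter. Powers of [q] cost only the geometric
    series [Q]. *)
Lemma vM_one_mod_le q X : prime q -> (1 < X)%N ->
  q.-1%:R * vM X (fun d => (d == 1 %[mod q]) && (0 < X %/ d < q)%N) <=
  lnn q * X%:R + q.-1%:R * lnn X.
Proof.
move=> pr_q X1; have q1 := prime_gt1 pr_q; have q0 := ltnW q1.
set V := vM _ _; set Y := (X %/ q)%N; have YX : (Y <= X)%N by exact: leq_div.
pose Q := vM X (fun d => if (q %| d)%N then (Y %/ d)%N else 0%N).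
have qR : 0 < q.-1%:R :> R by rewrite ltr0n -subn1 subn_gt0.
have hQ : Q <= lnn q * Y%:R / q.-1%:R.
  apply: (vM_dvd_le pr_q).
    by rewrite divr_ge0 ?mulr_ge0 ?lnn_ge0 // ltW.
  rewrite -mulr_sumr -mulrA ler_wpM2l ?lnn_ge0 // ler_pdivlMr //.
  rewrite -natr_sum -natrM ler_nat mulnC.
  exact: leq_trans (leq_addr _ _) (sum_div_exp_le Y X q1).
have h1 : lfact Y + V <= lsum (fun n => n == 1 %[mod q]) X + Q.
  rewrite (lfact_vM YX) (@lsum_vM _ X X) // -!vMD; apply: ler_vM => d d0.
  rewrite /Y divnAC; set u := (X %/ d)%N.
  have [qd|qd] := boolP (q %| d)%N.
    have -> : (d == 1 %[mod q]) = false.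
      by rewrite (eqP qd) modn_small //; case: (q) q1 => [|[]].
    by rewrite /= addn0 leq_addl.
  have cop : coprime d q by rewrite coprime_sym prime_coprime.
  rewrite addn0; have := cnt_inv_mod u q1 cop.
  case: andP => [[/eqP d1 /andP[u0 uq]]|_]; last by rewrite addn0.
  rewrite divn_small //= => _; rewrite add0n.
  apply: leq_ltn_trans (leq0n _) (ltn_cnt (e := 1) (u := 0) _ _) => //.
  by rewrite muln1 d1.
have h2 : lsum (fun n => n == 1 %[mod q]) X <= Y%:R * lnn q + lfact Y + lnn X.
  apply: le_trans (lsum_one_mod_le X q1) _.
  have KY : (X.-1 %/ q <= Y)%N by rewrite leq_div2r // leq_pred.
  have : (X.-1 %/ q)%:R * lnn q <= Y%:R * lnn q.
    by rewrite ler_wpM2r ?lnn_ge0 // ler_nat.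
  suff : lfact (X.-1 %/ q).+1 <= lfact Y + lnn X by lra.
  have mono a b : (a <= b)%N -> lfact a <= lfact b.
    move=> /subnKC <-; elim: (b - a)%N => [|k IH]; first by rewrite addn0.
    by rewrite addnS lfactS (le_trans IH) // lerDl lnn_ge0.
  rewrite lfactS lerD ?mono // ler_lnn //.
  by have := leq_div X.-1 q; lia.
have h3 : q%:R * Y%:R * lnn q <= X%:R * lnn q.
  by rewrite ler_wpM2r ?lnn_ge0 // -natrM ler_nat mulnC leq_divM.
have h4 : V <= Y%:R * lnn q + lnn X + Q by lra.
have h5 : q.-1%:R * Q <= lnn q * Y%:R.
  by rewrite mulrC -ler_pdivlMr.
have qE : q%:R = q.-1%:R + 1 :> R by rewrite natr1 prednK.
have : q.-1%:R * V <= q.-1%:R * (Y%:R * lnn q + lnn X + Q) by rewrite ler_pM2l.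
by move: h3; rewrite qE; lra.
Qed.

(** * The nonprincipal character modulo 3 *)

Lemma cnt_mod3 d u i : (0 < i < 3)%N ->
  cnt (fun e => (d * e) %% 3 == i)%N u =
  (if d %% 3 == 0 then 0 else if d %% 3 == i then (u + 2) %/ 3
   else (u + 1) %/ 3)%N.
Proof.
move=> i3; elim: u => [|u IH].
  by rewrite cnt0; case: ifP => // _; case: ifP.
rewrite cntS {}IH -modnMml.
have : (d %% 3 < 3)%N by rewrite ltn_pmod.
move: (d %% 3)%N => r.
by case: i i3 => [|[|[|i]]] // _; case: r => [|[|[|r]]] //= _; lia.
Qed.

Definition chi3sum (y : nat) : R :=
  lsum (fun n => n %% 3 == 1)%N y - lsum (fun n => n %% 3 == 2)%N y.

Lemma chi3sumS y : chi3sum y.+1 = chi3sum y +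
  (if (y.+1 %% 3 == 1)%N then lnn y.+1 else 0) -
  (if (y.+1 %% 3 == 2)%N then lnn y.+1 else 0).
Proof. by rewrite /chi3sum !lsumS; ring. Qed.

(** The nonzero terms alternate in sign and grow in size, so the sums over complete blocks of three
    stay between [- lnn (3 * k)] and 0. *)
Lemma chi3sum_le y : `| chi3sum y | <= lnn y.
Proof.
have step k : chi3sum (3 * k).+1 = chi3sum (3 * k) + lnn (3 * k).+1 /\
              chi3sum (3 * k).+2 = chi3sum (3 * k).+1 - lnn (3 * k).+2.
  rewrite !chi3sumS.
  have -> : ((3 * k).+1 %% 3 = 1)%N by lia.
  have -> : ((3 * k).+2 %% 3 = 2)%N by lia.
  by rewrite /=; split; ring.
(* At [a = 0] this rests on the default value [lnn 0 = 0]. *)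
have incr a : lnn a <= lnn a.+1.
  by case: a => [|a]; [rewrite {1}/lnn ln0 ?lnn_ge0 | rewrite ler_lnn].
have h k : - lnn (3 * k) <= chi3sum (3 * k) <= 0.
  elim: k => [|k /andP[IH1 IH2]].
    by rewrite muln0 /chi3sum !lsum0 subrr lexx andbT oppr_le0 lnn_ge0.
  rewrite mulnS !addSn add0n chi3sumS.
  have -> : ((3 * k).+3 %% 3 = 0)%N by lia.
  have [s1 ->] := step k; rewrite s1.
  have := incr (3 * k)%N; have := incr (3 * k).+1; have := incr (3 * k).+2.
  by move=> *; apply/andP; split=> /=; lra.
have [k yk] : exists k, [\/ y = 3 * k, y = (3 * k).+1 | y = (3 * k).+2]%N.
  exists (y %/ 3)%N; case: (y %% 3)%N (ltn_pmod y (isT : 0 < 3)%N)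
    (divn_eq y 3) => [|[|[|]]] // _ e.
  - by constructor 1; lia.
  - by constructor 2; lia.
  - by constructor 3; lia.
have /andP[h1 h2] := h k; have [s1 s2] := step k.
have := incr (3 * k)%N; have := incr (3 * k).+1.
have := lnn_ge0 (3 * k)%N.
by rewrite ler_norml; case: yk => -> *; apply/andP; split; lra.
Qed.

(* With [u = X / d], the weights of [lfact] and [chi3sum] are chosen so that a
   prime power [d] outside the classes 0 and 2 modulo 3 has total weight at most
   0 for [u < 10], while in the class 2 only those with [u = 2], that is
   [X / 3 < d <= X / 2], can have positive weight for [u < 10]. They are the
   optimal solution of a linear program over the divisors of 36. *)
Lemma chi3_weights_le X :
  lfact (X %/ 2) + lfact (X %/ 9) + lfact (X %/ 12) +
    chi3sum (X %/ 3) + chi3sum (X %/ 6) <=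
  lfact (X %/ 3) + lfact (X %/ 4) + lfact (X %/ 18) + lfact (X %/ 36) *+ 2 +
    chi3sum (X %/ 2) + chi3sum (X %/ 4) +
    (vM X (fun d => (d %% 3 == 2)%N && (X %/ d == 2)%N) +
     psi X (X %/ 10) +
     vM X (fun d => if (3 %| d)%N then (d <= X)%N : nat else 0%N)) *+ 2.
Proof.
have le k : (X %/ k <= X)%N by exact: leq_div.
rewrite /chi3sum; set a := lsum (fun n => n %% 3 == 1)%N.
set b := lsum (fun n => n %% 3 == 2)%N.
(* Subtracted terms change sides, so that all weights are natural numbers and [ler_vM] applies. *)
suff : lfact (X %/ 2) + lfact (X %/ 9) + lfact (X %/ 12) +
    (a (X %/ 3)%N + a (X %/ 6)%N + b (X %/ 2)%N + b (X %/ 4)%N) <=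
  lfact (X %/ 3) + lfact (X %/ 4) + lfact (X %/ 18) +
    (lfact (X %/ 36) + lfact (X %/ 36)) +
    (a (X %/ 2)%N + a (X %/ 4)%N + b (X %/ 3)%N + b (X %/ 6)%N) +
    (vM X (fun d => (d %% 3 == 2)%N && (X %/ d == 2)%N) +
     vM X (fun d => (d %% 3 == 2)%N && (X %/ d == 2)%N) +
     (psi X (X %/ 10) + psi X (X %/ 10)) +
     (vM X (fun d => if (3 %| d)%N then (d <= X)%N : nat else 0%N) +
     vM X (fun d => if (3 %| d)%N then (d <= X)%N : nat else 0%N))).
  by rewrite !mulr2n; lra.
rewrite /a /b /psi !(@lfact_vM X) // !(@lsum_vM _ X) // -!vMD.
apply: ler_vM => d d0.
rewrite -!(divn_gt0 _ d0) !(divnAC X _ d) !cnt_mod3 //.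
rewrite /dvdn; have := ltn_pmod d (isT : 0 < 3)%N.
move: (d %% 3)%N (X %/ d)%N => r u.
by case: r => [|[|[|r]]] //= _; lia.
Qed.

(** * Primes in short intervals *)

Lemma sqrt_floor_exists X : exists s, (s ^ 2 <= X < s.+1 ^ 2)%N.
Proof.
elim: X => [|X [s /andP[h1 h2]]]; first by exists 0%N.
by case: (ltnP X.+1 (s.+1 ^ 2)) => h3; [exists s|exists s.+1]; nia.
Qed.

Lemma sqrt_floor_ge X s k : (k * k <= X < s.+1 ^ 2)%N -> (k <= s)%N.
Proof.
move=> /andP[kX Xs]; rewrite -ltnS -(ltn_exp2r _ _ (isT : 0 < 2)%N) -mulnn.
exact: leq_ltn_trans Xs.
Qed.

(** Twice the tangent to [ln] at [2 ^ 10]; with [lnn 2 <= 7/10] the constant is [2 * (7 - 1)]. *)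
Lemma lnn_sqrt_le X s : (0 < X)%N -> (X < s.+1 ^ 2)%N ->
  lnn X <= 12 + s.+1%:R / 512.
Proof.
move=> X0 Xs.
have h1 : lnn X <= lnn s.+1 * 2 by rewrite -lnnX // ler_lnn // ltnW.
have h2 := @lnn_sub_le s.+1 (2 ^ 10)%N isT isT.
have [_ _ h3 _ _] := @lnn_small_bounds.
have h4 : (2 ^ 10)%N%:R = 1024 :> R by rewrite natrX; ring.
by move: h2; rewrite lnnX // h4; lra.
Qed.

Lemma lnn_trunc_log6_le X : (0 < X)%N ->
  178 / 100 * (trunc_log 6 X)%:R <= lnn X.
Proof.
move=> X0; have [_ h _ _ _] := @lnn_small_bounds.
have : lnn (6 ^ trunc_log 6 X)%N <= lnn X.
  by rewrite ler_lnn ?expn_gt0 // trunc_logP.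
rewrite lnnX // (_ : 6 = 2 * 3)%N // lnnM //; apply: le_trans.
by rewrite ler_wpM2r.
Qed.

(* The quadratic main term [c * X] beats the error terms, which are of order
   [sqrt X * ln X]. *)
Lemma error_terms_lt (c X s l r : R) : 5 / 100 <= c -> 700 <= s ->
  s * s <= X -> 0 <= l -> l <= 12 + (s + 1) / 512 -> 0 <= r ->
  178 / 100 * r <= l ->
  14 * l + 22 + s * l * 2 + (r + 1) * (5 * l + 6) * 2 < c * X.
Proof.
move=> hc hs hX l0 hl r0 hr.
pose M := 12 + (s + 1) / 512.
have h1 : s * l <= s * M by rewrite ler_wpM2l //; lra.
have h2 : (r + 1) * (5 * l + 6) <= (M * (57 / 100) + 1) * (5 * M + 6).
  by apply: ler_pM; rewrite /M; lra.
have h3 : 5 / 100 * (s * s) <= c * X by apply: ler_pM => //; nra.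
apply: lt_le_trans h3.
(* In terms of [t] the difference to be bounded is a polynomial with positive coefficients, which
   [lra] can handle. *)
have [t [t0 st]] : exists t, 0 <= t /\ s = 700 + t by exists (s - 700); lra.
have t2 : 0 <= t * t by rewrite mulr_ge0.
move: h1 h2 hl; rewrite /M st; lra.
Qed.

Lemma prime_not_one_mod_large q n :
  prime q -> (4 < q)%N -> (100 * 1000 <= n)%N ->
  exists p, [/\ prime p, (2 * n - 1 <= p <= 5 * n - 4)%N & p <> 1 %[mod q]].
Proof.
move=> pr_q q5 n9; set X := (5 * n - 4)%N.
(* The threshold on [n] yields [700 <= s], as [error_terms_lt] requires. *)
have X7 : (700 * 700 <= X)%N by rewrite /X; lia.
have n2 : (2 <= n)%N by lia.
clear n9; have X1 : (1 < X)%N by rewrite /X; lia.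
have [s /andP[s1 s2]] := sqrt_floor_exists X.
have [p /and3P[p1 p2 p3]|none] :=
  pickP (fun p : 'I_X.+1 => [&& prime p, 2 * n - 1 <= p & p != 1 %[mod q]])%N.
  by exists p; split=> //; [rewrite p2 -ltnS ltn_ord | apply/eqP].
exfalso.
have X0 := ltnW X1.
set r := trunc_log 6 X.
have Xr : (X < 6 ^ r.+1)%N by exact: trunc_log_ltn.
have Y1 : (2 * n - 2 <= X)%N by rewrite /X; lia.
have Y5 : ((2 * n - 2) * 5 <= 2 * X)%N by rewrite /X; lia.
have q4 : (4 <= q.-1)%N by lia.
have h1 := @psi_ge X X0.
have h2 := @psi_le X (2 * n - 2) r.+1 Y1 (leq_ltn_trans Y1 Xr).
pose V := vM X (fun d => (d == 1 %[mod q]) && (0 < X %/ d < q)%N).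
have h3 : q.-1%:R * V <= _ := @vM_one_mod_le q X pr_q X1.
have h4 := @vM_nonprime_le X s s2.
have h5 : psi X X <= psi X (2 * n - 2) + V +
    vM X (fun d => ~~ prime d && (d <= X)%N).
  rewrite /psi /V -!vMD; apply: ler_vM => d d0.
  case: (leqP d X) => // dX; have [//|dn] := leqP d (2 * n - 2).
  have [pr_d|_] := boolP (prime d); last by rewrite addn1.
  rewrite /= addn0 add0n.
  have dX' : (d < X.+1)%N by [].
  have := none (Ordinal dX'); rewrite /= pr_d /=.
  have -> : (2 * n - 1 <= d)%N by lia.
  move/negbFE ->; rewrite divn_gt0 // dX ltn_divLR //=.
  have : (5 * d <= q * d)%N by rewrite leq_mul2r q5 orbT.
  by rewrite /X; lia.
have [_ _ _ _ L5] := @lnn_small_bounds.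
have q1R : 0 < q.-1%:R :> R by rewrite ltr0n (leq_trans _ q4).
(* Tangent to [ln] at 5; [405/1000] is the bound [162/100] for [lnn 5] divided by 4. *)
have Lq : lnn q <= 405 / 1000 * q.-1%:R.
  have := @lnn_sub_le q 5 (prime_gt0 pr_q) isT.
  have : 4 <= q.-1%:R :> R by rewrite (ler_nat _ 4).
  by rewrite -{3}(prednK (prime_gt0 pr_q)) -[q.-1.+1%:R]natr1; lra.
have hV : V <= 405 / 1000 * X%:R + lnn X.
  rewrite -(ler_pM2l q1R); apply: le_trans h3 _.
  have : lnn q * X%:R <= 405 / 1000 * q.-1%:R * X%:R by rewrite ler_wpM2r.
  lra.
have hY : (2 * n - 2)%:R <= 2 / 5 * X%:R :> R.
  have : (2 * n - 2)%:R * 5 <= 2 * X%:R :> R by rewrite -!natrM ler_nat.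
  lra.
have s7 : 700 <= s%:R :> R by rewrite (ler_nat _ 700) (@sqrt_floor_ge X) // X7.
have sX : s%:R * s%:R <= X%:R :> R by rewrite -natrM ler_nat mulnn.
have hl := lnn_sqrt_le X0 s2; have hr := lnn_trunc_log6_le X0.
(* Main terms: [91/100] for [psi X X], against [2/5 * 111/100] for [psi] at [2 * n - 2] and
   [405/1000] for [V]; more than [6/100] is left. *)
have := @error_terms_lt (6 / 100) X%:R s%:R (lnn X) r%:R.
have l0 := lnn_ge0 X.
have e0 : 0 <= s%:R * lnn X by rewrite mulr_ge0.
have e1 : 0 <= (r%:R + 1) * (5 * lnn X + 6).
  by rewrite mulr_ge0 ?addr_ge0 ?mulr_ge0.
move: hl h2; rewrite -[s.+1%:R]natr1 -[r.+1%:R]natr1 => hl h2.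
have c6 : 5 / 100 <= 6 / 100 :> R by lra.
move=> /(_ c6 s7 sX l0 hl (ler0n _ _) hr); lra.
Qed.

Lemma prime_two_mod3_large n : (100 * 1000 <= n)%N ->
  exists p, [/\ prime p, (2 * n - 1 <= p <= 3 * n - 2)%N & p = 2 %[mod 3]].
Proof.
(* With this [X], the [d] with [X %/ d = 2] are exactly those from [2 * n - 1] to [3 * n - 2]. *)
move=> n9; set X := (6 * n - 4)%N.
have X7 : (700 * 700 <= X)%N by rewrite /X; lia.
have n2 : (2 <= n)%N by lia.
clear n9; have X1 : (1 < X)%N by rewrite /X; lia.
have [s /andP[s1 s2]] := sqrt_floor_exists X.
have [p /and3P[p1 p2 p3]|none] :=
  pickP (fun p : 'I_(3 * n - 2).+1 =>
    [&& prime p, 2 * n - 1 <= p & p == 2 %[mod 3]])%N.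
  by exists p; split=> //; [rewrite p2 -ltnS ltn_ord | apply/eqP].
exfalso.
have X0 := ltnW X1.
set r := trunc_log 6 X.
have Xr : (X < 6 ^ r.+1)%N by exact: trunc_log_ltn.
have h2 := @psi_le X (X %/ 10) r.+1 (leq_div _ _)
  (leq_ltn_trans (leq_div _ _) Xr).
have h4 := @vM_nonprime_le X s s2.
have h1 := @chi3_weights_le X.
have hV : vM X (fun d => (d %% 3 == 2)%N && (X %/ d == 2)%N) <=
    vM X (fun d => ~~ prime d && (d <= X)%N).
  apply: ler_vM => d d0; rewrite -(divn_gt0 X d0).
  case: andP => // -[d2 /eqP Xd]; rewrite Xd andbT.
  have [pr_d|//] := boolP (prime d).
  have e1 := divn_eq X d; have e2 := ltn_pmod X d0; rewrite Xd in e1.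
  have dn : (d < (3 * n - 2).+1)%N by move: e1; rewrite /X; lia.
  have nd : (2 * n - 1 <= d)%N by move: e1 e2; rewrite /X; lia.
  by have := none (Ordinal dn); rewrite /= pr_d nd (eqP d2).
have hW : vM X (fun d => if (3 %| d)%N then (d <= X)%N : nat else 0%N) <= lnn X.
  apply: (@vM_dvd_le X 3 (fun d => (d <= X)%N)) => //; first exact: lnn_ge0.
  exact: sum_prime_pow_le.
have chi k : (0 < k)%N -> `| chi3sum (X %/ k) | <= lnn X.
  move=> k0; apply: le_trans (chi3sum_le _) _.
  have [->|?] := posnP (X %/ k)%N; last by rewrite ler_lnn // leq_div.
  by rewrite {1}/lnn ln0 // lnn_ge0.
have := chi 2%N isT; have := chi 3%N isT.
have := chi 4%N isT; have := chi 6%N isT.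
rewrite !ler_norml => /andP[c6 c6'] /andP[c4 c4'] /andP[c3 c3'] /andP[c2 c2'].
have s7 : 700 <= s%:R :> R by rewrite (ler_nat _ 700) (@sqrt_floor_ge X) // X7.
have sX : s%:R * s%:R <= X%:R :> R by rewrite -natrM ler_nat mulnn.
have hl := lnn_sqrt_le X0 s2; have hr := lnn_trunc_log6_le X0.
have l0 := lnn_ge0 X.
have [_ _ _ L3 _] := @lnn_small_bounds.
(* In the weighted sum of the [lfact] bounds the terms in [lnn X] and [lnn 2] of order [X] cancel,
   leaving [lnn 3 / 4 >= 109/400] against [2 * 111/1000] from [psi]; more than [5/100] is left. *)
have := @error_terms_lt (5 / 100) X%:R s%:R (lnn X) r%:R.
move: hl h2; rewrite -[s.+1%:R]natr1 -[r.+1%:R]natr1 => hl h2.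
move=> /(_ (lexx _) s7 sX l0 hl (ler0n _ _) hr).
have hY : (X %/ 10)%:R * 10 <= X%:R :> R by rewrite -natrM ler_nat leq_divM.
have L3X : 109 / 100 * X%:R <= lnn 3 * X%:R by rewrite ler_wpM2r.
have L4 : lnn 4 = lnn 2 + lnn 2 by rewrite -lnnM.
have L9 : lnn 9 = lnn 3 + lnn 3 by rewrite -lnnM.
have L12 : lnn 12 = lnn 3 + lnn 4 by rewrite -lnnM.
have L18 : lnn 18 = lnn 2 + lnn 9 by rewrite -lnnM.
have L36 : lnn 36 = lnn 4 + lnn 9 by rewrite -lnnM.
have := @lfact_div_bounds X 2 X0 isT; have := @lfact_div_bounds X 3 X0 isT.
have := @lfact_div_bounds X 4 X0 isT; have := @lfact_div_bounds X 9 X0 isT.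
have := @lfact_div_bounds X 12 X0 isT; have := @lfact_div_bounds X 18 X0 isT.
have := @lfact_div_bounds X 36 X0 isT.
rewrite L36 L18 L12 L9 L4.
move=> /andP[_ g1] /andP[_ g2] /andP[g3 _] /andP[g4 _] /andP[_ g5] /andP[_ g6].
move=> /andP[g7 _] final.
by move: h1 (ler0n R X); rewrite !mulr2n; lra.
Qed.

End LogSums.

(* Each element [x] of the chain serves every [n] with [2 n - 1 <= x.1] and
   [x.2 <= top n]; the path condition leaves no gap between these ranges. *)
Lemma chain_cover (top : nat -> nat) (s : seq (nat * nat)) x n0 n :
  {homo top : a b / a <= b} -> x.2 <= top n0 -> n0 <= n ->
  path (fun x y => y.2 <= top (x.1.+1 %/ 2).+1) x s ->
  2 * n - 1 <= (last x s).1 ->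
  exists2 y, y \in x :: s & (2 * n - 1 <= y.1) && (y.2 <= top n).
Proof.
move=> top_homo; elim: s x n0 => [|y s IH] x n0 xtop n0n /=.
  by move=> _ nx; exists x; rewrite ?mem_head // nx (leq_trans xtop) ?top_homo.
move=> /andP[xy ys] nl; have [nx|nx] := leqP (2 * n - 1) x.1.
  by exists x; rewrite ?mem_head // nx (leq_trans xtop) ?top_homo.
have [|z zs zn] := IH y _ xy _ ys nl; first by lia.
by exists z => //; rewrite inE zs orbT.
Qed.

(** The bound [3 * n - 2] is [q * (n - 1) + 1] for [q = 3], and it is at most [6 * n - 17] exactly
    when [5 <= n]. *)
Lemma prime_two_mod3 n : 5 <= n ->
  exists p, [/\ prime p, 2 * n - 1 <= p <= 3 * n - 2 & p = 2 %[mod 3]].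
Proof.
move=> n5; case: (leqP (100 * 1000) n) => [|nlt].
  exact: (@prime_two_mod3_large Rdefinitions.R).
(* Primes that are 2 modulo 3, each at most about 3/2 times the one before. *)
pose s := [:: 17; 23; 29; 41; 59; 89; 131; 197; 293; 431; 647; 971; 1451; 2153;
  3221; 4817; 7211; 10799; 16193; 24281; 36389; 54581; 81869; 122789; 184181;
  276257].
pose t := [seq (p, p) | p <- s].
have [|||||y yt /andP[y1 y2]] :=
  @chain_cover (fun n => 3 * n - 2) t (11, 11) 5 n.
- by move=> a b; lia.
- by [].
- by [].
- by vm_compute.
- by apply: (@leq_trans (200 * 1000)); [lia | vm_compute].
have good : all (fun y => [&& prime y.1, y.1 == y.2 & y.1 == 2 %[mod 3]])
  ((11, 11) :: t) by vm_compute.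
have /and3P[pr_y /eqP e /eqP e3] := allP good _ yt.
clear good yt t s; exists y.1.
by split; [exact: pr_y | rewrite y1 e | exact: e3].
Qed.

(** The two upper bounds match the lower bounds for [m] in [distinct_mod_cases]; the second is the
    stronger one only for [n < 13]. *)
Lemma prime_not_one_mod q n : prime q -> 4 < q -> 5 <= n ->
  exists p, [/\ prime p, 2 * n - 1 <= p, p <= 5 * n - 4, p <= 6 * n - 17
    & p <> 1 %[mod q]].
Proof.
move=> pr_q q4 n5; case: (leqP (100 * 1000) n) => [nlt|nlt].
  have [p [pr_p /andP[p1 p2] p3]] :=
    @prime_not_one_mod_large Rdefinitions.R q n pr_q q4 nlt.
  by exists p; split=> //; lia.
pose t := [:: (19, 23); (43, 47); (107, 109); (269, 271); (661, 673);
  (1621, 1637); (4049, 4051); (10103, 10111); (25253, 25261); (63127, 63131);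
  (157793, 157799); (394409, 394481)].
have [|||||y yt] := @chain_cover (fun n => minn (5 * n - 4) (6 * n - 17)) t
  (11, 13) 5 n.
- by move=> a b; lia.
- by [].
- by [].
- by vm_compute.
- by apply: (@leq_trans (200 * 1000)); [lia | vm_compute].
rewrite leq_min => /and3P[y1 y2 y3].
(* Two primes whose difference is 3-smooth cannot both be 1 modulo [q]. *)
have good : all (fun y => [&& prime y.1, prime y.2, y.1 <= y.2
    & y.2 - y.1 %| 2 ^ 4 * 3 ^ 2]) ((11, 13) :: t) by vm_compute.
have /and4P[pr_y1 pr_y2 yy gap] := allP good _ yt.
clear good yt t.
case: (eqVneq (y.1 %% q) (1 %% q)) => [e1|e1]; last first.
  exists y.1; split=> //; last exact/eqP.
    exact: leq_trans y2.
  exact: leq_trans y3.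
case: (eqVneq (y.2 %% q) (1 %% q)) => [e2|e2]; last first.
  by exists y.2; split=> //; [exact: leq_trans yy | exact/eqP].
have : q %| 2 ^ 4 * 3 ^ 2.
  by apply: dvdn_trans gap; rewrite -eqn_mod_dvd // e1 e2.
rewrite Euclid_dvdM // !Euclid_dvdX // !dvdn_prime2 //.
by case/orP => /andP[/eqP e _]; move: q4; rewrite e.
Qed.

(** * Moduli separating the values *)

(** As [q] is prime to [p - 1], some [u] has [u * q] equal to 1 modulo [p - 1], and raising to the
    power [u] undoes the [q]-th power by Fermat's little theorem. *)
Lemma exp_mod_inj p q x y : prime p -> prime q -> p <> 1 %[mod q] ->
  x ^ q = y ^ q %[mod p] -> x = y %[mod p].
Proof.
move=> pr_p pr_q pq xy; have p0 := prime_gt0 pr_p.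
have pdvd z : (p %| z) = (p %| z ^ q).
  by rewrite Euclid_dvdX // prime_gt0 ?andbT.
have [px|px] := boolP (p %| x).
  have py : p %| y by rewrite pdvd /dvdn -xy -/(dvdn p (x ^ q)) -pdvd.
  by rewrite (eqP px) (eqP py).
have py : ~~ (p %| y) by rewrite pdvd /dvdn -xy -/(dvdn p (x ^ q)) -pdvd.
have cop : coprime q p.-1.
  rewrite prime_coprime //; apply/negP => qp; apply: pq.
  apply/eqP; rewrite eqn_mod_dvd // subn1 //.
have [[u v] /= uv] := coprimeP _ (prime_gt0 pr_q) cop.
have uvE : u * q = p.-1 * v + 1.
  by rewrite [p.-1 * v]mulnC -uv subnKC // ltnW // -subn_gt0 uv.
have powu z : ~~ (p %| z) -> (z ^ q) ^ u = z %[mod p].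
  move=> pz; rewrite -expnM mulnC uvE.
  rewrite expnD expn1 expnM -modnMml -modnXm.
  have := Euler_exp_totient (a := z) (n := p).
  rewrite coprime_sym prime_coprime // => /(_ pz).
  rewrite totient_prime // => ->.
  by rewrite modnXm exp1n modnMml mul1n.
by rewrite -(powu x px) -(powu y py) -modnXm xy modnXm.
Qed.

Lemma pronic_sub i x :
  (i.+1 + x) * (i.+1 + x - 1) - i.+1 * (i.+1 - 1) = x * (2 * i + x + 1).
Proof.
rewrite (_ : (i.+1 + x) * _ = i.+1 * (i.+1 - 1) + x * (2 * i + x + 1)).
  by rewrite addKn.
by rewrite addSn !subn1 /=; lia.
Qed.

Lemma distinct_mod_prime q n p : prime q -> prime p -> 2 * n - 1 <= p ->
  p <> 1 %[mod q] -> distinct_mod q n p.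
Proof.
move=> pr_q pr_p np pq.
suff H j k : 1 <= j -> j < k -> k <= n ->
    j ^ q * (j - 1) ^ q <> k ^ q * (k - 1) ^ q %[mod p].
  move=> j k /andP[j1 jn] /andP[k1 kn] jk.
  case: (ltngtP j k) => [lt|lt|//]; first exact: H.
  by move=> e; exact: (H k j).
case: j => // i _ ik kn; rewrite -!expnMn.
move=> /(exp_mod_inj pr_p pr_q pq)/esym/eqP.
have [x x0 kE] : exists2 x, 0 < x & k = i.+1 + x.
  by exists (k - i.+1); rewrite ?subn_gt0 // subnKC // ltnW.
rewrite eqn_mod_dvd; last by apply: leq_mul; rewrite ?leq_sub2r // ltnW.
rewrite {1 2}kE pronic_sub Euclid_dvdM //.
(* The left side is [k + j - 1] for [j = i.+1], at most [2 * n - 2] since [j < k <= n]. *)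
have ixp : 2 * i + x + 1 < p by clear -np kn kE x0; lia.
have xp : x < p by apply: leq_ltn_trans ixp; clear; lia.
have ix0 : 0 < 2 * i + x + 1 by rewrite addn1.
case/orP => /dvdn_leq h; first by have := h x0; rewrite leqNgt xp.
by have := h ix0; rewrite leqNgt ixp.
Qed.

(** For [x < y] solve [k - j = x], [k + j - 1 = y]; then [x + y < 2 * n] would force [k <= n].
    Asking only for divisibility lets [x * y] be [2 * m]. *)
Lemma distinct_mod_factor q n m x y : distinct_mod q n m -> 0 < x -> 0 < y ->
  odd (x + y) -> m %| x * y -> 2 * n <= x + y.
Proof.
wlog xy : x y / x <= y => [H|] D x0 y0 oxy mxy.
  case: (leqP x y) => [|/ltnW] le; first exact: H.
  by rewrite addnC; apply: H; rewrite // 1?addnC 1?mulnC.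
rewrite leqNgt; apply/negP => xyn.
have xlty : x < y.
  rewrite ltn_neqAle xy andbT; apply/eqP => e.
  by move: oxy; rewrite e oddD addbb.
pose i := (y - x).-1./2.
have yE : y = 2 * i + x + 1.
  have : odd (y - x) by rewrite oddB // -oddD addnC.
  by rewrite /i; have := odd_double_half (y - x).-1; lia.
apply: (D i.+1 (i.+1 + x)); [by lia|by lia|by lia|].
apply/esym/eqP; rewrite -!expnMn -modnXm -[in X in _ == X]modnXm.
suff -> : (i.+1 + x) * (i.+1 + x - 1) = i.+1 * (i.+1 - 1) %[mod m] by [].
apply/eqP; rewrite eqn_mod_dvd; last by apply: leq_mul; lia.
by rewrite pronic_sub -yE.
Qed.

(** Take the factors [m] and 1 for even [m], and [m] and 2 for odd [m], where parity improves
    [2 * n - 2] to [2 * n - 1]. *)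
Lemma distinct_mod_ge q n m : distinct_mod q n m -> 1 < m -> 2 * n - 1 <= m.
Proof.
move=> D m1; case: (boolP (odd m)) => om.
  have := @distinct_mod_factor _ _ _ m 2 D; rewrite oddD om => /(_ _ isT isT).
  by rewrite dvdn_mulr // => /(_ (ltnW m1) isT); lia.
have := @distinct_mod_factor _ _ _ m 1 D.
rewrite oddD (negbTE om) => /(_ _ isT isT).
by rewrite dvdn_mulr // => /(_ (ltnW m1) isT); lia.
Qed.

(** The values at [2 <= k <= n] are distinct roots of [X ^ t - 1] with [t = (m - 1) / q]; [k = 1] is
    left out, as its value is 0. *)
Lemma distinct_mod_prime_one q n m : distinct_mod q n m -> prime m -> 1 < q ->
  1 < n -> m = 1 %[mod q] -> q * (n - 1) + 1 <= m.
Proof.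
move=> D pr_m q1 n1 mq; have m1 := prime_gt1 pr_m.
have nm := distinct_mod_ge D m1.
have q0 := ltnW q1.
have qdvd : q %| m.-1 by rewrite -subn1 -eqn_mod_dvd ?mq // ltnW.
pose t := m.-1 %/ q; have mt : m.-1 = t * q by rewrite divnK.
have t0 : 0 < t by rewrite divn_gt0 // dvdn_leq //; lia.
pose F k : 'F_m := ((k * (k - 1)) ^ q)%:R%R.
have natF a b : (a%:R == b%:R :> 'F_m)%R = (a == b %[mod m]).
  by rewrite -(inj_eq val_inj) /= !val_Fp_nat.
have := @max_poly_roots 'F_m ('X^t - 1)%R [seq F k | k <- iota 2 n.-1].
rewrite size_XnsubC // size_map size_iota -size_poly_eq0 size_XnsubC //.
move=> /(_ isT) H.
suff : n.-1 < t.+1.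
  by move=> nt; have : q * (n - 1) <= q * t; [rewrite leq_mul2l; lia | lia].
apply: H.
  apply/allP => z /mapP[k]; rewrite mem_iota => /andP[k2 kn] ->.
  rewrite /root !hornerE /F -natrX subr_eq0 -[1%R]/(1%:R)%R natF.
  rewrite -expnM [q * t]mulnC -mt.
  have := @Euler_exp_totient (k * (k - 1)) m.
  rewrite totient_prime // => -> //.
  rewrite coprimeMl !(coprime_sym _ m) !prime_coprime //.
  by apply/andP; split; apply/negP => /dvdn_leq; lia.
have range k : k \in iota 2 n.-1 -> 1 <= k <= n.
  by rewrite mem_iota; clear -n1; lia.
rewrite map_inj_in_uniq ?iota_uniq // => j k /range hj /range hk.
rewrite /F => /eqP; rewrite natF !expnMn => /eqP e.
by apply/eqP/negPn/negP => /eqP jk; apply: (D j k).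
Qed.

(** Since [k * (k - 1)] is even, all values vanish modulo [2 ^ e], so a collision modulo [c] lifts
    by the Chinese remainder theorem. *)
Lemma distinct_mod_odd_part q n c e : e <= q -> odd c ->
  distinct_mod q n (c * 2 ^ e) -> distinct_mod q n c.
Proof.
move=> eq oc D j k hj hk jk E; apply: (D j k hj hk jk).
have even i : 2 ^ e %| i ^ q * (i - 1) ^ q.
  apply: dvdn_trans (dvdn_exp2l 2 eq) _; rewrite -expnMn dvdn_exp2r //.
  by case: i => // i; rewrite subn1 dvdn2 oddM /= andNb.
apply/eqP; rewrite chinese_remainder ?coprimeXr ?coprimen2 // E eqxx /=.
by rewrite (eqP (even j)) (eqP (even k)).
Qed.

(** Expand [(a - 3) * (b - 6) >= 0]; for [b < 6] both factors are 3 or 5. Equality holds at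
    [a = b = 5], [n = 7]. *)
Lemma odd_factor_bound a b n : odd a -> odd b -> 2 < a <= b ->
  2 * n <= 2 * a + b -> 6 * n - 17 <= a * b.
Proof.
move=> oa ob /andP[a3 ab] h; case: (leqP 6 b) => b6.
  have := leq_mul (leqnn (a - 3)) (leqnn (b - 6)).
  rewrite -(subnKC a3) -(subnKC b6) in h *; lia.
have a6 := leq_ltn_trans ab b6.
by move: a b oa ob a3 ab b6 a6 h =>
  [|[|[|[|[|[|a]]]]]] // [|[|[|[|[|[|b]]]]]] //; lia.
Qed.

Lemma distinct_mod_cases q n m : prime q -> odd q -> 1 < n -> 1 < m ->
  distinct_mod q n m ->
  [\/ exists c, [/\ c <= m, prime c, 2 * n - 1 <= c & c <> 1 %[mod q]],
      q * (n - 1) + 1 <= m | 6 * n - 17 <= m].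
Proof.
move=> pr_q oq n1 m1 D; have q2 := prime_gt1 pr_q.
have q3 : 2 < q.
  by rewrite ltn_neqAle q2 andbT; apply/eqP => e; rewrite -e in oq.
have [c] := pfactor_coprime (isT : prime 2) (ltnW m1).
rewrite coprime2n; set e := logn 2 m => oc mE.
have c0 : 0 < c by case: c oc {mE}.
have cm : c <= m by rewrite mE leq_pmulr // expn_gt0.
have [eq|eq] := leqP e q.
  have Dc : distinct_mod q n c.
    by apply: (@distinct_mod_odd_part _ _ _ e) => //; rewrite -mE.
  have c1 : 1 < c.
    rewrite ltn_neqAle c0 andbT; apply/eqP => c1; rewrite -c1 in Dc.
    by apply: (Dc 1 2) => //; rewrite ?n1 ?(ltnW n1) // !modn1.
  have [pr_c|npr_c] := boolP (prime c).
    have [c1q|c1q] := eqVneq (c %% q) (1 %% q).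
      constructor 2; apply: leq_trans cm.
      exact: distinct_mod_prime_one Dc pr_c q2 n1 c1q.
    constructor 1; exists c; split=> //; last exact/eqP.
    exact: distinct_mod_ge Dc c1.
  constructor 3; apply: leq_trans cm.
  have [a a1 ac] : exists2 a, 1 < a < c & a %| c.
    by case/primePn: npr_c => [|[a]]; [lia | exists a].
  have [b cE] := dvdnP ac.
  have [oa ob] : odd a /\ odd b by apply/andP; rewrite andbC -oddM -cE.
  (* Doubling one of two odd factors makes their sum odd, and [c] still divides the product. *)
  have h x y : x * y = c -> odd y -> 0 < x -> 0 < y -> 2 * n <= 2 * x + y.
    move=> xy oy x0 y0; apply: (distinct_mod_factor Dc); rewrite ?muln_gt0 //.
      by rewrite oddD oddM oy.
    by rewrite -mulnA xy dvdn_mull.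
  have b1 : 1 < b.
    by case: b cE {ob} => [|[|b]] cE //; lia.
  have a0 : 0 < a by case/andP: a1 => /ltnW.
  have h1 : 2 * n <= 2 * a + b by apply: h; rewrite // 1?mulnC // ltnW.
  have h2 : 2 * n <= 2 * b + a by apply: h; rewrite // ltnW.
  have a3 : 2 < a by case: (a) oa a1 => [|[|[|]]].
  have b3 : 2 < b by case: (b) ob b1 => [|[|[|]]].
  rewrite cE; case: (leqP a b) => ab.
    by rewrite [b * a]mulnC; apply: odd_factor_bound; rewrite // a3.
  by apply: odd_factor_bound; rewrite // b3 ltnW.
constructor 3; rewrite mE.
have [c1|c1] := leqP c 1.
  have {c1} c1 : c = 1 by lia.
  rewrite c1 mul1n in mE *.
  (* The ceiling of [e / q]: the value at [2 ^ f] is divisible by [m = 2 ^ e] and collides with the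
     value 0 at 1. Hence [n < 2 ^ f], while [m >= 2 ^ (3 * f - 2)]. *)
  pose f := (e.-1 %/ q).+1.
  have ef : e <= f * q.
    have := ltn_pmod e.-1 (ltnW q2).
    by rewrite /f; have := divn_eq e.-1 q; lia.
  have fe : (f - 1) * 3 + 1 <= e.
    have : (f - 1) * 3 <= (f - 1) * q by rewrite leq_mul2l q3 orbT.
    by have := leq_divM e.-1 q; rewrite /f subn1 /=; lia.
  have f2 : 1 < f by rewrite /f ltnS divn_gt0; lia.
  have nf : n < 2 ^ f.
    rewrite ltnNge; apply/negP => fn.
    have k1 : 1 < 2 ^ f by rewrite (ltn_exp2l 0) //; lia.
    apply: (D 1 (2 ^ f)); [by lia|by lia|by lia|].
    rewrite subnn exp0n ?muln0 ?mod0n; last by lia.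
    apply/esym/eqP; rewrite -/(dvdn m _) mE dvdn_mulr // -expnM.
    exact: dvdn_exp2l.
  have : 2 ^ ((f - 1) * 3 + 1) <= 2 ^ e by rewrite leq_exp2l.
  apply: leq_trans; case: f f2 nf {ef fe} => [|[|f]] // _.
  have -> : (f.+2 - 1) * 3 + 1 = f + f + f + 4 by lia.
  rewrite !expnS !expnD; have : 0 < 2 ^ f by rewrite expn_gt0.
  move: (2 ^ f) => [|[|w]] // _ nw; clear -nw; first by lia.
  have : w.+2 * 4 <= w.+2 * w.+2 * w.+2.
    by rewrite -mulnA leq_pmul2l // (@leq_mul 2 2).
  by lia.
(* The factors [2 ^ e] and [c] have odd sum and both exceed 2, so [(2 ^ e - 3) * (c - 3) >= 0] gives
   even [6 * n - 9 <= m]. *)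
have e4 : 8 < 2 ^ e by rewrite (@ltn_exp2l 2 3); lia.
have := @distinct_mod_factor _ _ _ (2 ^ e) c D.
have c3 : 2 < c by case: (c) oc c1 => [|[|[|]]].
have -> : odd (2 ^ e + c).
  by rewrite oddD oc addbT oddX; case: (e) eq.
rewrite mE mulnC dvdnn => /(_ _ _ isT isT); nia.
Qed.

(** As 7 is 1 modulo 3, the prime for [q = 3], [n = 4] is 11, beyond the general bounds
    [q * (n - 1) + 1 = 10] and [6 * n - 17 = 7]. *)
Lemma no_distinct_mod_3_4 m : 1 < m < 11 -> ~ distinct_mod 3 4 m.
Proof.
move=> m11 D.
have : all (fun m => has (fun j => has (fun k => (j != k) &&
      (j ^ 3 * (j - 1) ^ 3 == k ^ 3 * (k - 1) ^ 3 %[mod m]))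
    (iota 1 4)) (iota 1 4)) (iota 2 9) by vm_compute.
move=> /allP/(_ m); rewrite mem_iota => /(_ m11) /hasP[j jI] /hasP[k kI].
move=> /andP[/eqP jk /eqP]; apply: D jk.
  by move: jI; rewrite mem_iota.
by move: kI; rewrite mem_iota.
Qed.

Lemma good_prime_le q n m : prime q -> odd q -> 0 < n -> 1 < m ->
  distinct_mod q n m ->
  exists r, [/\ r <= m, prime r, 2 * n - 1 <= r & r <> 1 %[mod q]].
Proof.
move=> pr_q oq n0 m1 D; have q1 := prime_gt1 pr_q.
have q2 : q != 2 by apply: contraTneq oq => ->.
have not_one r : 0 < r -> ~~ (q %| r.-1) -> r <> 1 %[mod q].
  by move=> r0 /negP nd e; apply: nd; rewrite -subn1 -eqn_mod_dvd ?e.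
have nd2 : ~~ (q %| 2) by rewrite dvdn_prime2.
have nd4 : ~~ (q %| 2 * 2) by rewrite Euclid_dvdM // negb_or nd2.
have m2n := distinct_mod_ge D m1.
have [n5|n5] := leqP 5 n.
  have n2 : 1 < n by apply: leq_trans n5.
  have [q4|q4] := leqP q 4.
    have q3 : q = 3.
      move: q1 q2 q4 oq; clear.
      by case: q => [|[|[|[|[|]]]]].
    have [r [pr_r /andP[r1 r2] r3]] := prime_two_mod3 n5.
    have rq : r <> 1 %[mod q] by rewrite q3 r3.
    have [[c [cm pr_c c1 cq]]|h|h] := distinct_mod_cases pr_q oq n2 m1 D.
    - by exists c.
    - exists r; split=> //; apply: leq_trans r2 _; apply: leq_trans h.
      by rewrite q3; clear -n2; lia.
    - exists r; split=> //; apply: leq_trans r2 _; apply: leq_trans h.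
      by clear -n5; lia.
  have [r [pr_r r1 r2 r3 rq]] := prime_not_one_mod pr_q q4 n5.
  have [[c [cm pr_c c1 cq]]|h|h] := distinct_mod_cases pr_q oq n2 m1 D.
  - by exists c.
  - exists r; split=> //; apply: leq_trans r2 _; apply: leq_trans h.
    have : 5 * (n - 1) <= q * (n - 1) by rewrite leq_mul2r q4 orbT.
    by clear -n2; lia.
  - by exists r; split=> //; exact: leq_trans h.
(* The primes are 2, 3, 5, 7 for [n = 1, 2, 3, 4]; an odd prime [q] divides [r - 1] only if [r = 7]
   and [q = 3]. *)
case: n n0 n5 m2n D => [//|[|[|[|[|//]]]]] _ _ m2n D.
- by exists 2; split=> //; apply: not_one => //; rewrite dvdn1 gtn_eqF.
- by exists 3; split=> //; apply: not_one.
- by exists 5; split=> //; apply: not_one.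
have [q3|q3] := eqVneq q 3.
  rewrite q3 in D *; exists 11; split=> //.
  rewrite leqNgt; apply/negP => m11.
  by apply: (@no_distinct_mod_3_4 m) D; rewrite m1.
exists 7; split=> //; apply: not_one => //.
by rewrite (_ : 7.-1 = 2 * 3) // Euclid_dvdM // negb_or nd2 dvdn_prime2.
Qed.

(** This modulus exceeds all the values. Through [good_prime_le] it yields the existence of an
    admissible prime; [.+2] makes it visibly larger than 1. *)
Lemma distinct_mod_large q n : 0 < q -> distinct_mod q n ((n * n) ^ q).+2.
Proof.
move=> q0 j k /andP[j1 jn] /andP[k1 kn] jk; rewrite -!expnMn.
have small i : i <= n -> (i * (i - 1)) ^ q < ((n * n) ^ q).+2.
  move=> le_in; rewrite ltnS ltnW // ltnS leq_exp2r // leq_mul //.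
  exact: leq_trans (leq_subr _ _) le_in.
rewrite !modn_small ?small // => /eqP; rewrite eqn_exp2r // => /eqP e.
by apply: jk; clear -e j1 k1; nia.
Qed.

Theorem theorem1p4 (q n : nat) (q_prime : prime q) (q_odd : odd q)
    (n_gt0 : 0 < n) :
  exists p : nat,
    is_least (fun m => 1 < m /\ distinct_mod q n m) p /\
    is_least (fun r => [/\ prime r, 2 * n - 1 <= r & r <> 1 %[mod q]]) p.
Proof.
pose good r := [&& prime r, 2 * n - 1 <= r & r != 1 %[mod q]].
have goodP r : reflect [/\ prime r, 2 * n - 1 <= r & r <> 1 %[mod q]] (good r).
  by apply: (iffP and3P) => -[? ? ?]; split=> //; apply/eqP.
have ex : exists r, good r.
  have [r [_ pr_r nr rq]] := good_prime_le q_prime q_odd n_gt0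
    (isT : 1 < ((n * n) ^ q).+2) (@distinct_mod_large q n (prime_gt0 q_prime)).
  by exists r; apply/goodP.
case: (ex_minnP ex) => p /goodP[pr_p np pq] p_min.
exists p; split; split.
- by split; [exact: prime_gt1 | exact: distinct_mod_prime].
- move=> m [m1 D].
  have [r [rm pr_r nr rq]] := good_prime_le q_prime q_odd n_gt0 m1 D.
  by apply: leq_trans rm; apply/p_min/goodP.
- by split.
- by move=> r hr; apply/p_min/goodP.
Qed.
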